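(* Let $\lambda=(\lambda_1,\lambda_2)$, $\alpha=(1,a)$, $\beta=(2,b)$ with $1<b<\lambda_2<a<\lambda_1$, and let $P=P_\lambda$. Then \begin{align*} \mathbb{P}(P;\alpha<\beta) &=\frac{f^{\lambda/(a)}+\sum_{t=1}^{b-1} f^{(a-1,t)}\,f^{(\lambda_1-t,\lambda_2-t)/(a-t)}}{f^\lambda}\\ &=\frac{f^{\lambda/(a)}}{f^\lambda}+\sum_{t=1}^{b-1} f^{(a-1,t)}\,\frac{f^{(\lambda_1-t,\lambda_2-t)/(a-t)}}{f^{(\lambda_1-t,\lambda_2-t)}}\cdot\frac{f^{(\lambda_1-t,\lambda_2-t)}}{f^\lambda}. \end{align*} Moreover, for fixed cells $\alpha=(1,a)$, $\beta=(2,b)$ with $1<b<a$, and for any positive integer $r$, $$\lim_{\substack{(\lambda_1,\lambda_2)\to(\infty,\infty)\\ \lambda_2\le\lambda_1\le\lambda_2+r}}\mathbb{P}(P_{(\lambda_1,\lambda_2)};\alpha<\beta)=2^{-a}\left((a+1)+\sum_{t=1}^{b-1}\frac{(a-1+t)!}{a!\,t!}(a-t)(a-t+1)2^{-t}\right).$$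
   Context: The cell poset $P_\lambda$ of a partition $\lambda=(\lambda_1,\lambda_2)$, $\lambda_1\ge\lambda_2\ge1$, is the set of cells $(i,j)$ with $i\in\{1,2\}$, $1\le j\le\lambda_i$, ordered componentwise: $(i,j)\le(i',j')$ iff $i\le i'$ and $j\le j'$. For a subpartition $\mu\subseteq\lambda$ ($\mu_i\le\lambda_i$ for all $i$, missing parts counted as $0$), $P_{\lambda/\mu}$ is the subposet of cells of $\lambda$ that are not cells of $\mu$. For a finite poset $Q$, $e(Q)$ is the number of linear extensions of $Q$ and $e(Q;\alpha<\beta)$ is the number of linear extensions placing $\alpha$ before $\beta$; $\mathbb{P}(Q;\alpha<\beta)=e(Q;\alpha<\beta)/e(Q)$. Put $f^\lambda=e(P_\lambda)$ and $f^{\lambda/\mu}=e(P_{\lambda/\mu})$ (the numbers of standard Young tableaux of shape $\lambda$, respectively $\lambda/\mu$). One-row partitions are written $(m)$. *)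

(* Defs.v *)
From HB Require Import structures.
From mathcomp Require Import all_boot all_order all_algebra finmap.
From mathcomp Require Import all_classical all_reals all_analysis.

Set Implicit Arguments.
Unset Strict Implicit.
Unset Printing Implicit Defensive.

Import Order.TTheory GRing.Theory Num.Theory.
Import numFieldNormedType.Exports.

Local Open Scope fset_scope.

(* A finite poset is a finite subset [Q] of an ambient poset [T], with the
   induced order.  A linear extension of [Q] is a listing of the elements of
   [Q], each exactly once, in which smaller elements come first. *)
Definition linear_extensions d (T : porderType d) (Q : {fset T}) : seq (seq T) :=
  [seq s <- permutations (enum_fset Q) |
    all2rel (fun x y => (x < y)%O ==> (index x s < index y s)%N) s].

Definition num_linext d (T : porderType d) (Q : {fset T}) : nat :=
  size (linear_extensions Q).

(* Meaningful only when both [al] and [be] belong to [Q]: [index x s] is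
   [size s] when [x] is not in [s]. *)
Definition num_linext_before d (T : porderType d) (Q : {fset T}) (al be : T) : nat :=
  count (fun s => (index al s < index be s)%N) (linear_extensions Q).

Definition prob_before (R : realType) d (T : porderType d) (Q : {fset T})
    (al be : T) : R :=
  ((num_linext_before Q al be)%:R / (num_linext Q)%:R)%R.

(* [*p] is the product type with the componentwise order. *)
Notation cell := (nat *p nat)%type.

(* A partition is the list of its parts, so that the part [lam_i] (with
   [i >= 1]) is [nth 0 lam i.-1], and missing parts are [0]. *)
Definition cell_poset (lam : seq nat) : {fset cell} :=
  [fset c : cell in
    [seq ((i, j) : cell) | i <- iota 1 (size lam), j <- iota 1 (nth 0%N lam i.-1)]].

Definition skew_poset (lam mu : seq nat) : {fset cell} :=
  cell_poset lam `\` cell_poset mu.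

Definition num_syt (lam : seq nat) : nat := num_linext (cell_poset lam).

Definition num_skew_syt (lam mu : seq nat) : nat := num_linext (skew_poset lam mu).

(* Main.v *)
(* A linear extension of a two-row skew shape is a lattice path: state (x, y)
   records that x cells of the first row and y cells of the second row have
   been listed, and y <= x throughout.  Cell (1, a) comes before (2, b) exactly
   when the path makes its a-th horizontal step from some (a-1, t) with t < b;
   cutting the path there gives the sum over t.  The number of paths from (x, y)
   to (p, q) depends only on the differences p-x, q-y and x-y, which accounts for
   the shift by t columns.  By the reflection principle it is a difference of two
   binomial coefficients, so its ratio to the number of paths from (0, 0) is a
   product of falling factorials and of a difference quotient of falling
   factorials at the two nearby points q-y and p-y+1; after dividing by powers
   of p+q, it tends to (x-y+1) / 2^(x+y) as long as p-q stays bounded. *)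

Require Import Defs.
From HB Require Import structures.
From mathcomp Require Import all_boot all_order all_algebra finmap.
From mathcomp Require Import all_classical all_reals all_analysis.
From mathcomp Require Import zify ring.

Set Implicit Arguments.
Unset Strict Implicit.
Unset Printing Implicit Defensive.

Import Order.TTheory GRing.Theory Num.Theory.
Import numFieldNormedType.Exports.

Local Open Scope fset_scope.

(** * Linear extensions of a finite poset and their recursion on the first element *)

Lemma linext_uniq d (T : porderType d) (Q : {fset T}) :
  uniq (linear_extensions Q).
Proof. by rewrite filter_uniq // permutations_uniq. Qed.

Lemma linextP d (T : porderType d) (Q : {fset T}) (s : seq T) :
  reflect [/\ uniq s, s =i Q &
      {in s &, forall x y, (x < y)%O -> (index x s < index y s)%N}]
    (s \in linear_extensions Q).
Proof.
rewrite mem_filter mem_permutations; apply: (iffP andP) => [[h1 h2]|[us sQ h]].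
  split.
  - by rewrite (perm_uniq h2) fset_uniq.
  - exact: perm_mem h2.
  - by move=> x y xs ys; apply/implyP; exact: (allrelP h1).
split; first by apply/allrelP => x y xs ys; apply/implyP; exact: h.
by apply: uniq_perm => //; rewrite fset_uniq.
Qed.

(** Deleting the head lowers every other index by one, so the conditions between the remaining
    elements are unchanged; the conditions involving the head only say that nothing in [Q] lies
    below it. *)
Lemma cons_linext d (T : porderType d) (Q : {fset T}) (x : T) (s : seq T) :
  ((x :: s) \in linear_extensions Q) =
  [&& x \in Q, all (fun y => ~~ (y < x)%O) Q & s \in linear_extensions (Q `\ x)].
Proof.
apply/linextP/and3P => [[/= /andP[xs us] sQ h]|[xQ mx /linextP[us sQ h]]].
  split.
  - by rewrite -sQ inE eqxx.
  - apply/allP => y; rewrite -[_ \in _](sQ y) => ys; apply/negP => yx.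
    by have := h _ _ ys (mem_head _ _) yx; rewrite /= eqxx.
  - apply/linextP; split => //.
      move=> y; rewrite !inE -sQ inE; case: eqVneq => //= ->.
      exact/negbTE.
    move=> y z ys zs yz.
    have := h y z; rewrite !inE ys zs !orbT => /(_ isT isT yz).
    have nx w : w \in s -> (x == w) = false.
      by move=> ws; apply: contraNF xs => /eqP->.
    by rewrite /= !nx.
have xs : x \notin s by rewrite sQ !inE eqxx.
split => /=.
- by rewrite xs.
- by move=> y; rewrite inE sQ !inE; case: eqVneq => [->|].
move=> y z; rewrite !inE => ys zs yz.
have yQ : y \in Q by case/orP: ys => [/eqP->//|]; rewrite sQ !inE => /andP[].
case: (eqVneq x z) yz => [<-|xz] yz.
  by have /negP := allP mx _ yQ.
case: eqVneq => // xy; rewrite ltnS.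
by move: ys zs; rewrite eq_sym (negbTE xy) eq_sym (negbTE xz) /= => ys zs; exact: h.
Qed.

Lemma linext0 d (T : porderType d) : linear_extensions (fset0 : {fset T}) = [:: [::]].
Proof.
have e : enum_fset (fset0 : {fset T}) = [::].
  by apply: size0nil; exact: (cardfs0 T).
by rewrite /linear_extensions e.
Qed.

(** Sorts the listings by their head, which runs over the list [m] of minimal elements. The
    predicate [P] is arbitrary so that one recursion serves both the full count and the count of
    listings with one cell before another. *)
Lemma count_linext_rec d (T : porderType d) (Q : {fset T}) (m : seq T)
    (P : pred (seq T)) :
  Q != fset0 -> uniq m ->
  (forall x, (x \in m) = (x \in Q) && all (fun y => ~~ (y < x)%O) Q) ->
  count P (linear_extensions Q) =
  \sum_(x <- m) count (fun s => P (x :: s)) (linear_extensions (Q `\ x)).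
Proof.
move=> Q0 um mE.
have /permP-> : perm_eq (linear_extensions Q)
    [seq x :: s | x <- m, s <- linear_extensions (Q `\ x)].
  apply: uniq_perm; first exact: linext_uniq.
    apply: allpairs_uniq_dep => //; first by move=> x _; exact: linext_uniq.
    by move=> [x s] [y t] _ _ /= [-> ->].
  case=> [|x s].
    transitivity false.
      apply/negbTE/negP => /linextP[_ sQ _]; case/fset0Pn: Q0 => x.
      by rewrite -sQ.
    by apply/esym/negbTE/negP => /allpairsPdep[x [t []]].
  rewrite cons_linext andbA -mE; apply/andP/allpairsPdep => [[h1 h2]|].
    by exists x, s.
  by case=> y [t [h1 h2 [-> ->]]].
rewrite count_flatten -map_comp sumnE big_map; apply: eq_bigr => x _.
by rewrite /= count_map.
Qed.

(** * Two-row skew shapes and the first step of a lattice path *)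

Lemma mem_cell_poset2 (p q : nat) (c : cell) :
  (c \in cell_poset [:: p; q]) =
  ((c.1 == 1%N) && (0 < c.2 <= p)) || ((c.1 == 2) && (0 < c.2 <= q)).
Proof.
case: c => i j; rewrite !inE /= orbF.
have mem1 k n : ((i, j) \in [seq ((k, j0) : cell) | j0 <- iota 1 n])
    = (i == k) && (0 < j <= n).
  apply/mapP/andP => [[j0 +[-> ->]]|[/eqP-> h]].
    by rewrite mem_iota add1n ltnS.
  by exists j => //; rewrite mem_iota add1n ltnS.
by rewrite !mem1.
Qed.

Lemma mem_skew2 (p q x y : nat) (c : cell) :
  (c \in skew_poset [:: p; q] [:: x; y]) =
  ((c.1 == 1%N) && (x < c.2 <= p)) || ((c.1 == 2) && (y < c.2 <= q)).
Proof. rewrite inE !mem_cell_poset2; case: c => i j /=; lia. Qed.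

Lemma lt_cell (c e : cell) : (c < e)%O = [&& c != e, c.1 <= e.1 & c.2 <= e.2]%N.
Proof. by rewrite lt_neqAle Order.ProdOrder.leEprod. Qed.

(** The minimal cells of the skew shape; [nseq] with a boolean length yields a conditional
    singleton. *)
Definition first_cells (p q x y : nat) : seq cell :=
  [seq ((1%N, x.+1) : cell) | _ <- nseq (x < p) tt] ++
  [seq ((2, y.+1) : cell) | _ <- nseq ((y < q) && (y < x)) tt].

Lemma cell_eq (c e : cell) : (c == e) = (c.1 == e.1) && (c.2 == e.2).
Proof. by []. Qed.

(** The first step is horizontal or vertical. A vertical step needs [y < x]: if [y = x], then
    [q <= p] puts the unlisted cell (1, y+1) in the shape, below (2, y+1). *)
Lemma count_skew2_rec (P : pred (seq cell)) (p q x y : nat) :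
  (y <= x)%N -> (q <= p)%N -> (x < p) || (y < q) ->
  count P (linear_extensions (skew_poset [:: p; q] [:: x; y])) =
  ((if x < p then count (fun s => P ((1%N, x.+1) :: s))
      (linear_extensions (skew_poset [:: p; q] [:: x.+1; y])) else 0) +
   (if (y < q) && (y < x) then count (fun s => P ((2%N, y.+1) :: s))
      (linear_extensions (skew_poset [:: p; q] [:: x; y.+1])) else 0))%N.
Proof.
move=> yx qp ne.
rewrite (@count_linext_rec _ _ _ (first_cells p q x y)).
- rewrite /first_cells big_cat /= !big_map; congr (_ + _)%N.
  + case: ifP => xp; rewrite ?big_nil // big_seq1; congr (count _ (linear_extensions _)).
    apply/fsetP => -[i j]; rewrite in_fsetD1 !mem_skew2 cell_eq /=; lia.
  + case: ifP => xp; rewrite ?big_nil // big_seq1; congr (count _ (linear_extensions _)).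
    apply/fsetP => -[i j]; rewrite in_fsetD1 !mem_skew2 cell_eq /=; lia.
- apply/fset0Pn; case/orP: ne => h; [exists (1%N, x.+1)|exists (2%N, y.+1)];
  by rewrite mem_skew2 /= ltnSn h ?orbT.
- by rewrite /first_cells; case: (x < p)%N; case: (_ && _).
move=> [i j].
transitivity ([&& x < p, i == 1 & j == x.+1] || [&& y < q, y < x, i == 2 & j == y.+1]).
  rewrite /first_cells; case: (x < p)%N; case: (y < q); case: (y < x);
  by rewrite ?inE ?cell_eq /= ?orbF.
apply/idP/andP.
  move=> h; rewrite mem_skew2; split => /=; first by lia.
  by apply/allP => -[k l]; rewrite [_ \in _]mem_skew2 lt_cell cell_eq /=; lia.
rewrite mem_skew2 => -[/= h /allP mn].
have := mn (1%N, x.+1); rewrite [_ \in _]mem_skew2 lt_cell cell_eq /=.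
have := mn (2%N, y.+1); rewrite [_ \in _]mem_skew2 lt_cell cell_eq /=.
lia.
Qed.

(** * Counting paths: recursion, reflection and invariance under column shifts *)

Lemma skew2_nil (p q : nat) : skew_poset [:: p; q] [:: p; q] = fset0.
Proof. by rewrite /skew_poset fsetDv. Qed.

Lemma num_skew2_nil (p q : nat) : num_skew_syt [:: p; q] [:: p; q] = 1%N.
Proof. by rewrite /num_skew_syt skew2_nil /num_linext linext0. Qed.

Lemma num_skew2_rec (p q x y : nat) :
  (y <= x)%N -> (q <= p)%N -> (x < p) || (y < q) ->
  num_skew_syt [:: p; q] [:: x; y] =
  ((if x < p then num_skew_syt [:: p; q] [:: x.+1; y] else 0) +
   (if (y < q) && (y < x) then num_skew_syt [:: p; q] [:: x; y.+1] else 0))%N.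
Proof.
move=> yx qp ne; rewrite /num_skew_syt /num_linext -!count_predT.
exact: count_skew2_rec.
Qed.

(* Reflection principle: the subtracted binomial counts the unconstrained paths
   from the mirror image (y-1, x+1) of (x, y). *)
Lemma num_skew2_bin (p q x y : nat) :
  (y <= x <= p)%N -> (y <= q <= p)%N ->
  (num_skew_syt [:: p; q] [:: x; y] + 'C(p + q - x - y, (p - y).+1)
   = 'C(p + q - x - y, p - x))%N.
Proof.
move: {2}(p + q - x - y)%N (erefl (p + q - x - y)%N) => n.
elim: n x y => [|n IH] x y nE /andP[yx xp] /andP[yq qp].
  have -> : x = p by lia.
  have -> : y = q by lia.
  by rewrite num_skew2_nil subnn bin0 bin_small //; lia.
rewrite num_skew2_rec //; last lia.
(* With the first row exhausted only one path remains, and the reflected binomial vanishes. *)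
case: (ltnP x p) => xp'; last first.
  have {xp xp'} ? : x = p by lia.
  subst x; rewrite add0n ifT; last lia.
  have := IH p y.+1; rewrite subnn !bin0 !bin_small; lia.
have := IH x.+1 y.
have -> : (p + q - x.+1 - y = n)%N by lia.
rewrite nE.
have -> : (p - x = (p - x.+1).+1)%N by lia.
case: ifP => yqx.
  have := IH x y.+1.
  have -> : (p + q - x - y.+1 = n)%N by lia.
  have -> : ((p - y.+1).+1 = p - y)%N by lia.
  have -> : (p - x = (p - x.+1).+1)%N by lia.
  rewrite !binS; lia.
rewrite !binS.
(* A vertical step is barred for one of two reasons. At [y = q] the Pascal terms that it would
   account for vanish; on the diagonal [x = y] they agree on the two sides and cancel. *)
have [yqE|xyE] : (y = q \/ (x = y)) by lia.
  rewrite [X in (_ + (_ + X))%N]bin_small; last lia.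
  rewrite [X in (_ = X + _)%N]bin_small; lia.
have -> : (p - y)%N = (p - x.+1).+1 by lia.
lia.
Qed.

(** Both counts satisfy the reflection identity with the same two binomials; [t <= y] keeps the
    subtractions from truncating. *)
Lemma num_skew2_shift (p q x y t : nat) :
  (t <= y)%N -> (y <= x <= p)%N -> (y <= q <= p)%N ->
  num_skew_syt [:: (p - t)%N; (q - t)%N] [:: (x - t)%N; (y - t)%N] =
  num_skew_syt [:: p; q] [:: x; y].
Proof.
move=> ty h1 h2; apply/eqP; rewrite -(eqn_add2r 'C(p + q - x - y, (p - y).+1)).
rewrite num_skew2_bin //.
have -> : (p - x = p - t - (x - t))%N by lia.
have -> : (p + q - x - y = p - t + (q - t) - (x - t) - (y - t))%N by lia.
have -> : (p - y = p - t - (y - t))%N by lia.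
by rewrite num_skew2_bin //; lia.
Qed.

(** * Listings with (1, a) before (2, b): cutting the path at its a-th horizontal step *)

Definition before_pred (a b : nat) (s : seq cell) : bool :=
  (index (1%N, a) s < index (2%N, b) s)%N.

Lemma before_pred_cons1 (a b j : nat) (s : seq cell) :
  before_pred a b ((1%N, j) :: s) = (j == a) || before_pred a b s.
Proof.
rewrite /before_pred /= !xpair_eqE /=.
by case: (j == a).
Qed.

Lemma before_pred_cons2 (a b j : nat) (s : seq cell) :
  before_pred a b ((2%N, j) :: s) = (j != b) && before_pred a b s.
Proof.
rewrite /before_pred /= !xpair_eqE /=.
by case: (j == b).
Qed.

(** The term [t] counts paths from (x, y) to (a-1, t), continued by the horizontal step to (a, t)
    and then to (p, q). The proof is by induction along the path, both sides obeying the recursion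
    on its first step. *)
Lemma before_skew2 (p q a b x y : nat) :
  (y <= x < a)%N -> (y < b < a)%N -> (a <= p)%N -> (b <= q <= p)%N ->
  num_linext_before (skew_poset [:: p; q] [:: x; y]) (1%N, a) (2%N, b) =
  (\sum_(y <= t < b) num_skew_syt [:: a.-1; t] [:: x; y]
      * num_skew_syt [:: p; q] [:: a; t])%N.
Proof.
move: {2}(a + b - x - y)%N (leqnn (a + b - x - y)%N) => n.
rewrite -[LHS]/(count (before_pred a b) (linear_extensions _)).
elim: n x y => [|n IH] x y nE yxa yba ap bqp; first by lia.
rewrite count_skew2_rec; [|lia..].
(* The vertical branch. If [y.+1 = b], then (2, b) is listed while (1, a) is still missing: the
   count is zero, and so is the empty sum. *)
have step2 : (if (y < q) && (y < x) then count (fun s => before_pred a b ((2%N, y.+1) :: s))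
      (linear_extensions (skew_poset [:: p; q] [:: x; y.+1])) else 0)%N =
   (if (y < x) then \sum_(y.+1 <= t < b) num_skew_syt [:: a.-1; t] [:: x; y.+1]
      * num_skew_syt [:: p; q] [:: a; t] else 0)%N.
  have -> : (y < q)%N by lia.
  rewrite /=; case: ifP => // yx.
  have [yb|yb] := eqVneq y.+1 b.
    rewrite yb big_geq //; apply/eqP; rewrite -leqn0 -ltnS.
    rewrite (eq_count (a2 := pred0)) ?count_pred0 // => s.
    by rewrite before_pred_cons2 eqxx.
  rewrite -IH; [|lia..].
  by apply: eq_count => s; rewrite before_pred_cons2 yb.
rewrite step2.
have xp : (x < p)%N by lia.
rewrite xp.
(* If [x.+1 = a], the horizontal step is the cut itself: every continuation is favourable, which
   gives the term [t = y], and the terms with larger [t] begin with a vertical step. *)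
have [xa|xa] := eqVneq x.+1 a.
  rewrite (eq_count (a2 := predT)); last first.
    by move=> s; rewrite before_pred_cons1 xa eqxx.
  rewrite count_predT -/(num_linext _) -/(num_skew_syt _ _).
  have yx : (y < x)%N by lia.
  rewrite yx [RHS]big_ltn; last lia.
  subst a; rewrite /= [num_skew_syt [:: x; y] _]num_skew2_nil mul1n; congr (_ + _)%N.
  apply: eq_big_nat => t tb; congr (_ * _)%N.
  rewrite [RHS]num_skew2_rec; [|lia..].
  by rewrite ltnn yx ifT //; lia.
rewrite (eq_count (a2 := before_pred a b)); last first.
  by move=> s; rewrite before_pred_cons1 (negbTE xa).
rewrite IH; [|lia..].
(* A zero term is added at [t = y], so that both branches range over the same [t] and combine
   termwise by the recursion for [num_skew_syt [:: a.-1; t] [:: x; y]]. *)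
have -> : ((if (y < x) then \sum_(y.+1 <= t < b) num_skew_syt [:: a.-1; t] [:: x; y.+1]
      * num_skew_syt [:: p; q] [:: a; t] else 0) =
   \sum_(y <= t < b) (if (y < t) && (y < x) then num_skew_syt [:: a.-1; t] [:: x; y.+1] else 0)
      * num_skew_syt [:: p; q] [:: a; t])%N.
  rewrite [RHS]big_ltn; last lia.
  rewrite ltnn mul0n add0n; case: ifP => yx.
    by apply: eq_big_nat => t /andP[-> _].
  by rewrite big1 // => t; rewrite andbF.
rewrite -big_split; apply: eq_big_nat => t tb.
rewrite /= -mulnDl; congr (_ * _)%N.
rewrite [RHS]num_skew2_rec; [|lia..].
by have -> : (x < a.-1)%N by lia.
Qed.

(** * From binomials to falling factorials *)

Lemma bin_shift_ffact (p q x y : nat) :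
  (y <= x <= p)%N -> (y <= q)%N ->
  ('C(p + q - x - y, (p - y).+1) * (((p - y).+1)`! * (q - y)`!)
   = (p + q - x - y)`! * (q - y) ^_ (x - y).+1)%N.
Proof.
move=> yxp yq; case: (ltnP x q) => xq; last first.
  by rewrite bin_small ?ffact_small ?muln0 //; lia.
rewrite -(@bin_fact (p + q - x - y) (p - y).+1); last lia.
rewrite -(@ffact_fact (q - y) (x - y).+1); last lia.
have -> : (p + q - x - y - (p - y).+1 = q - y - (x - y).+1)%N by lia.
lia.
Qed.

(** Multiplying the reflection identity by (p-y+1)! (q-y)! turns both binomials into falling
    factorials of the same length x-y+1, with the common factor (p+q-x-y)!. *)
Lemma num_skew2_ffact (p q x y : nat) :
  (y <= x <= p)%N -> (y <= q <= p)%N ->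
  (num_skew_syt [:: p; q] [:: x; y] * (((p - y).+1)`! * (q - y)`!)
     + (p + q - x - y)`! * (q - y) ^_ (x - y).+1
   = (p + q - x - y)`! * ((p - y).+1) ^_ (x - y).+1)%N.
Proof.
move=> yxp yqp; rewrite -bin_shift_ffact //; last lia.
rewrite -mulnDl num_skew2_bin //.
rewrite -(@bin_fact (p + q - x - y) (p - x)); last lia.
rewrite -(@ffact_fact (p - y).+1 (x - y).+1); last lia.
have -> : (p + q - x - y - (p - x) = q - y)%N by lia.
have -> : ((p - y).+1 - (x - y).+1 = p - x)%N by lia.
lia.
Qed.

Lemma num_syt2_skew0 (p q : nat) :
  num_syt [:: p; q] = num_skew_syt [:: p; q] [:: 0%N; 0%N].
Proof.
congr num_linext; apply/fsetP => -[i j].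
by rewrite mem_skew2 mem_cell_poset2.
Qed.

Lemma num_skew2_row (p q a : nat) :
  num_skew_syt [:: p; q] [:: a] = num_skew_syt [:: p; q] [:: a; 0%N].
Proof. by []. Qed.

(** The hook length formula for two rows: at x = y = 0 both falling factorials have length one and
    differ by p-q+1. *)
Lemma num_syt2_fact (p q : nat) : (q <= p)%N ->
  (num_syt [:: p; q] * (p.+1`! * q`!) = (p + q)`! * (p - q).+1)%N.
Proof.
move=> qp; rewrite num_syt2_skew0.
have := @num_skew2_ffact p q 0 0; rewrite !subn0 !ffactn1; nia.
Qed.

Lemma before_syt2 (p q a b : nat) :
  (0 < b < a)%N -> (a <= p)%N -> (b <= q <= p)%N ->
  num_linext_before (cell_poset [:: p; q]) (1%N, a) (2%N, b) =
  (num_skew_syt [:: p; q] [:: a] +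
   \sum_(1 <= t < b) num_syt [:: (a - 1)%N; t]
      * num_skew_syt [:: (p - t)%N; (q - t)%N] [:: (a - t)%N])%N.
Proof.
move=> ba ap bqp.
have -> : cell_poset [:: p; q] = skew_poset [:: p; q] [:: 0%N; 0%N].
  by apply/fsetP => -[i j]; rewrite mem_skew2 mem_cell_poset2.
rewrite before_skew2; [|lia..].
rewrite big_ltn; last lia.
congr (_ + _)%N.
  (* The term [t = 0] has weight 1, since a one-row shape has a single tableau. *)
  have := @num_syt2_fact a.-1 0 isT.
  rewrite num_syt2_skew0 addn0 subn0 muln1 factS => h.
  have := fact_gt0 a.-1; move: h (num_skew2_row p q a).
  nia.
apply: eq_big_nat => t tb.
rewrite num_syt2_skew0 subn1; congr (_ * _)%N.
(* Removing [t] columns turns the inner shape (a, t) into the one-row shape (a-t). *)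
have := @num_skew2_shift p q a t t; rewrite subnn num_skew2_row => -> //; lia.
Qed.

(** * Limits of falling factorials and of their difference quotients *)

Local Open Scope classical_set_scope.
Local Open Scope ring_scope.

Section limits.
Context {R : realType}.

Definition falling (k : nat) (v : R) : R := \prod_(i < k) (v - i%:R).

Lemma fallingS k v : falling k.+1 v = falling k v * (v - k%:R).
Proof. by rewrite /falling big_ord_recr. Qed.

(** Truncated subtraction does no harm: once [k] exceeds [n], a factor zero is already present on
    both sides. *)
Lemma natr_ffact (n k : nat) : (n ^_ k)%:R = falling k n%:R.
Proof.
elim: k => [|k IH]; first by rewrite /falling big_ord0 ffactn0.
rewrite fallingS -IH ffactnSr natrM; case: (leqP k n) => kn; first by rewrite natrB.
by rewrite ffact_small // !mul0r.
Qed.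

(** One power of [N] goes to each factor, and (u - i)/N has the same limit as u/N because i/N tends
    to 0. *)
Lemma cvg_falling (T : Type) (F : set_system T) {FF : Filter F} (u N : T -> R) (c : R) k :
  (fun t => u t / N t) @ F --> c -> (fun t => (N t)^-1) @ F --> (0 : R) ->
  (fun t => falling k (u t) / N t ^+ k) @ F --> c ^+ k.
Proof.
move=> uc N0; elim: k => [|k IH].
  rewrite expr0 (_ : (fun _ => _) = cst 1); first exact: cvg_cst.
  by apply/funext => t; rewrite /falling big_ord0 expr0 divr1.
rewrite exprSr (_ : (fun _ => _) =
    (fun t => falling k (u t) / N t ^+ k * (u t / N t - k%:R * (N t)^-1))); last first.
  by apply/funext => t; rewrite fallingS exprSr invfM; ring.
apply: cvgM => //; rewrite -[c in _ --> c]subr0 -(mulr0 k%:R).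
by apply: cvgB => //; apply: cvgM => //; exact: cvg_cst.
Qed.

(* Induction on k: Delta_k := falling k (u + d) - falling k u satisfies
   Delta_(k+1) = Delta_k * (u + d - k) + d * falling k u. *)
Lemma cvg_diff_falling (T : Type) (F : set_system T) {FF : Filter F}
    (u d N : T -> R) (c : R) k :
  (forall t, d t != 0) ->
  (fun t => u t / N t) @ F --> c -> (fun t => (u t + d t) / N t) @ F --> c ->
  (fun t => (N t)^-1) @ F --> (0 : R) ->
  (fun t => (falling k.+1 (u t + d t) - falling k.+1 (u t)) / d t / N t ^+ k) @ F
    --> k.+1%:R * c ^+ k.
Proof.
move=> d0 uc vc N0; elim: k => [|k IH].
  rewrite expr0 mulr1 (_ : (fun _ => _) = cst 1); first exact: cvg_cst.
  apply/funext => t; rewrite /falling !big_ord1 /= !subr0 expr0 divr1 addrAC subrr add0r.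
  by rewrite divff.
rewrite (_ : (fun _ => _) = (fun t =>
   (falling k.+1 (u t + d t) - falling k.+1 (u t)) / d t / N t ^+ k
     * ((u t + d t) / N t - k.+1%:R * (N t)^-1) + falling k.+1 (u t) / N t ^+ k.+1));
  last first.
  apply/funext => t; rewrite ![falling k.+2 _]fallingS.
  set A := falling _ (_ + _); set B := falling _ _.
  have -> : A * (u t + d t - k.+1%:R) - B * (u t - k.+1%:R) =
     (A - B) * (u t + d t - k.+1%:R) + d t * B by ring.
  rewrite [(_ + d t * B) / d t]mulrDl [d t * B]mulrC mulfK // exprSr invfM.
  by ring.
have -> : k.+2%:R * c ^+ k.+1 = k.+1%:R * c ^+ k * (c - k.+1%:R * 0) + c ^+ k.+1.
  by rewrite exprSr; ring.
apply: cvgD; last exact: cvg_falling.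
apply: cvgM => //; apply: cvgB => //; apply: cvgM => //; exact: cvg_cst.
Qed.

(** Quotient of the falling-factorial formula by the hook length formula. The factor p-q+1 of the
    latter is exactly the gap between the points q-y and p-y+1, so it supplies the denominator of a
    difference quotient. *)
Lemma num_skew2_ratio (p q x y : nat) :
  (y <= x <= q)%N -> (q <= p)%N ->
  (num_skew_syt [:: p; q] [:: x; y])%:R / (num_syt [:: p; q])%:R =
  falling y p.+1%:R * falling y q%:R / falling (x + y) (p + q)%:R
  * ((falling (x - y).+1 (q%:R - y%:R + (p - q).+1%:R)
      - falling (x - y).+1 (q%:R - y%:R)) / (p - q).+1%:R)
  :> R.
Proof.
move=> /andP[yx xq] qp.
have fn0 n : (n`!)%:R != 0 :> R by rewrite pnatr_eq0 -lt0n fact_gt0.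
have -> : q%:R - y%:R + (p - q).+1%:R = (p - y).+1%:R :> R.
  by rewrite -natrB ?(leq_trans yx) // -natrD; congr _%:R; lia.
rewrite -natrB ?(leq_trans yx) // -!natr_ffact.
have := congr1 (fun n => n%:R : R) (@num_skew2_ffact p q x y ltac:(lia) ltac:(lia)).
have := congr1 (fun n => n%:R : R) (@num_syt2_fact p q qp).
(* Each factorial of the hook length formula is split so that its tail is a factorial of the skew
   formula and cancels against it. *)
rewrite -(@ffact_fact p.+1 y); last lia.
rewrite -(@ffact_fact q y); last lia.
rewrite -(@ffact_fact (p + q) (x + y)); last lia.
have -> : (p.+1 - y = (p - y).+1)%N by lia.
have -> : (p + q - (x + y) = p + q - x - y)%N by lia.
have h1 := fn0 (p - y).+1; have h2 := fn0 (q - y)%N; have h3 := fn0 (p + q - x - y)%N.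
have ffn0 n k : (k <= n)%N -> (n ^_ k)%:R != 0 :> R.
  by move=> kn; rewrite pnatr_eq0 -lt0n ffact_gt0.
have h4 := @ffn0 p.+1 y ltac:(lia).
have h5 := @ffn0 q y ltac:(lia).
have h6 := @ffn0 (p + q)%N (x + y)%N ltac:(lia).
have h7 : (p - q).+1%:R != 0 :> R by rewrite pnatr_eq0.
move: h1 h2 h3 h4 h5 h6 h7.
move: ((q - y) ^_ _)%N ((p - y).+1 ^_ _)%N => D1 D2.
move: ((p - y).+1`!)%N ((q - y)`!)%N ((p + q - x - y)`!)%N => A B C.
move: (p.+1 ^_ y)%N (q ^_ y)%N ((p + q) ^_ (x + y))%N => P Q N.
move: (p - q).+1 (num_syt _) (num_skew_syt _ _) => d f g.
move=> A0 B0 C0 P0 Q0 N0 d0; rewrite !(natrD, natrM) => ef eg.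
have -> : f%:R = N%:R * C%:R * d%:R / (P%:R * A%:R * (Q%:R * B%:R)) :> R.
  by rewrite -ef; field; rewrite A0 B0 P0 Q0.
have -> : g%:R = C%:R * (D2%:R - D1%:R) / (A%:R * B%:R) :> R.
  by rewrite mulrBr -eg; field; rewrite A0 B0.
by field; rewrite A0 B0 C0 P0 Q0 N0 d0.
Qed.

(** * Asymptotics for shapes whose rows differ by at most [r] *)

Section near_diagonal.
Context (r : nat).

Let diag : set_system (nat * nat) :=
  within [set l : nat * nat | (l.2 <= l.1 <= l.2 + r)%N] (filter_prod \oo \oo).

Let diagF : Filter diag. Proof. exact: within_filter. Qed.
#[local] Existing Instance diagF.

Lemma near_diag_le : \forall l \near diag, (l.2 <= l.1 <= l.2 + r)%N.
Proof. exact: withinT. Qed.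

Lemma near_diag_ge (n : nat) : \forall l \near diag, (n <= l.2)%N.
Proof. by apply: filterS (filter_prod2 (nbhs_infty_ge n)) => l. Qed.

Lemma cvg_inv_sum_diag :
  (fun l => (l.1 + l.2)%:R^-1) @ diag --> (0 : R).
Proof.
have h : (fun l : nat * nat => @harmonic R l.1) @ diag --> (0 : R).
  apply: cvg_within_filter.
  exact: (@cvg_comp _ _ _ fst harmonic _ _ _ cvg_fst cvg_harmonic).
(* [harmonic] at [l.1] is 1/(l.1 + 1), an upper bound as soon as [l.2] is at least 1. *)
apply: (squeeze_cvgr _ (cvg_cst 0) h); near=> l.
rewrite invr_ge0 ler0n /= lef_pV2 ?posrE ?ltr0n ?ler_nat //;
  have : (1 <= l.2)%N by near: l; exact: near_diag_ge.
  lia.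
lia.
Unshelve. all: by end_near. Qed.

(** The width of the strip enters here: it bounds the numerator by r+1. *)
Lemma cvg_gap_diag :
  (fun l => (l.1 - l.2).+1%:R / (l.1 + l.2)%:R) @ diag --> (0 : R).
Proof.
have h : (fun l : nat * nat => r.+1%:R * (l.1 + l.2)%:R^-1) @ diag --> (0 : R).
  rewrite -(mulr0 r.+1%:R); apply: cvgM; [exact: cvg_cst|exact: cvg_inv_sum_diag].
apply: (squeeze_cvgr _ (cvg_cst 0) h); near=> l.
rewrite mulr_ge0 ?invr_ge0 ?ler0n //= ler_wpM2r ?invr_ge0 // ler_nat.
have : (l.2 <= l.1 <= l.2 + r)%N by near: l; exact: near_diag_le.
lia.
Unshelve. all: by end_near. Qed.

(** With N = p+q and g = p-q+1 one has q = (N - g + 1)/2, hence u/N = 1/2 + (c - 1/2) g/N + (d +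
    1/2)/N. The affine form covers the points q, p+1, q-y and p-y+1 at once. *)
Lemma cvg_row_diag (u : nat * nat -> R) (c d : R) :
  (\forall l \near diag, u l = l.2%:R + c * (l.1 - l.2).+1%:R + d) ->
  (fun l => u l / (l.1 + l.2)%:R) @ diag --> (2^-1 : R).
Proof.
move=> uE.
have h : (fun l : nat * nat => 2^-1 + (c - 2^-1) * ((l.1 - l.2).+1%:R / (l.1 + l.2)%:R)
     + (d + 2^-1) * (l.1 + l.2)%:R^-1) @ diag --> (2^-1 : R).
  rewrite -[X in _ --> X]addr0 -[X in _ --> X + _]addr0.
  rewrite -[X in _ --> _ + X + _](mulr0 (c - 2^-1)) -[X in _ --> _ + X](mulr0 (d + 2^-1)).
  apply: cvgD; first apply: cvgD; first exact: cvg_cst.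
    by apply: cvgM; [exact: cvg_cst|exact: cvg_gap_diag].
  by apply: cvgM; [exact: cvg_cst|exact: cvg_inv_sum_diag].
apply: cvg_trans h; apply: near_eq_cvg; near=> l.
have -> : u l = l.2%:R + c * (l.1 - l.2).+1%:R + d by near: l.
have : (l.2 <= l.1 <= l.2 + r)%N by near: l; exact: near_diag_le.
have : (1 <= l.2)%N by near: l; exact: near_diag_ge.
move: l.1 l.2 => p q q1 qp.
have N0 : (p + q)%:R != 0 :> R by rewrite pnatr_eq0; lia.
have -> : (p - q).+1%:R = p%:R - q%:R + 1 :> R by rewrite -natr1 natrB //; lia.
by move: N0; rewrite natrD => N0; field.
Unshelve. all: by end_near. Qed.

Lemma cvg_skew2_ratio (x y : nat) : (y <= x)%N ->
  (fun l => (num_skew_syt [:: l.1; l.2] [:: x; y])%:R / (num_syt [:: l.1; l.2])%:R)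
    @ diag --> ((x - y).+1%:R * 2^-1 ^+ (x + y) : R).
Proof.
move=> yx; set h := (x - y)%N.
have natd : forall l : nat * nat, (l.2 <= l.1 <= l.2 + r)%N ->
    (l.1 - l.2).+1%:R = l.1%:R - l.2%:R + 1 :> R.
  by move=> l lE; rewrite -natr1 natrB //; lia.
have N0 := cvg_inv_sum_diag.
have c1 : (fun l => falling y l.1.+1%:R / (l.1 + l.2)%:R ^+ y) @ diag --> (2^-1 ^+ y : R).
  apply: cvg_falling => //; apply: (@cvg_row_diag _ 1 0); near=> l.
  by rewrite natd -?natr1; [ring|near: l; exact: near_diag_le].
have c2 : (fun l => falling y l.2%:R / (l.1 + l.2)%:R ^+ y) @ diag --> (2^-1 ^+ y : R).
  by apply: cvg_falling => //; apply: (@cvg_row_diag _ 0 0); near=> l; ring.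
have c3 : (fun l => falling (x + y) (l.1 + l.2)%:R / (l.1 + l.2)%:R ^+ (x + y)) @ diag
    --> (1 : R).
  rewrite -[X in _ --> X](expr1n _ (x + y)); apply: cvg_falling => //.
  apply: cvg_near_cst; near=> l; rewrite divff // pnatr_eq0.
  have : (1 <= l.2)%N by near: l; exact: near_diag_ge.
  lia.
have c4 : (fun l => (falling h.+1 (l.2%:R - y%:R + (l.1 - l.2).+1%:R)
       - falling h.+1 (l.2%:R - y%:R))
     / (l.1 - l.2).+1%:R / (l.1 + l.2)%:R ^+ h) @ diag --> (h.+1%:R * 2^-1 ^+ h : R).
  apply: cvg_diff_falling => //.
    by apply: (@cvg_row_diag _ 0 (- y%:R)); near=> l; ring.
  by apply: (@cvg_row_diag _ 1 (- y%:R)); near=> l; ring.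
(* The limit as a product of the limits [c1] to [c4]. The powers of p+q cancel because x+y =
   h+y+y. *)
have -> : h.+1%:R * 2^-1 ^+ (x + y) =
    2^-1 ^+ y * 2^-1 ^+ y / 1 * (h.+1%:R * 2^-1 ^+ h) :> R.
  have -> : (x + y = h + y + y)%N by rewrite /h; lia.
  by rewrite !exprD divr1; ring.
apply: cvg_trans (cvgM (cvgM (cvgM c1 c2) (cvgV (oner_neq0 _) c3)) c4).
apply: near_eq_cvg; near=> l.
have lE : (l.2 <= l.1 <= l.2 + r)%N by near: l; exact: near_diag_le.
have xl : (x <= l.2)%N by near: l; exact: near_diag_ge.
have l1 : (1 <= l.2)%N by near: l; exact: near_diag_ge.
rewrite num_skew2_ratio; [|lia..].
have N1 : (l.1 + l.2)%:R != 0 :> R by rewrite pnatr_eq0; lia.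
have : falling (x + y) (l.1 + l.2)%:R != 0 :> R.
  by rewrite -natr_ffact pnatr_eq0 -lt0n ffact_gt0; lia.
have -> : (x + y = h + y + y)%N by rewrite /h; lia.
have d0 : (l.1 - l.2).+1%:R != 0 :> R by rewrite pnatr_eq0.
rewrite /= -/h !exprD.
move: d0 (expf_neq0 h N1) (expf_neq0 y N1).
move: (_ ^+ h) (_ ^+ y) => Nh Ny.
move: (falling _ _) (falling _ _) (falling _ _) (falling _ _) (falling _ _) => A B C D E.
move: (_.+1%:R) => d d0 Nh0 Ny0 E0.
by field; rewrite d0 Nh0 Ny0 E0.
Unshelve. all: by end_near. Qed.

End near_diagonal.

(** * Tableau numbers as reals and the probability as a quotient *)

Lemma num_syt2_neq0 (p q : nat) : (q <= p)%N -> (num_syt [:: p; q])%:R != 0 :> R.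
Proof.
move=> qp; rewrite pnatr_eq0 -lt0n -(@ltn_pmul2r (p.+1`! * q`!)).
  by rewrite mul0n num_syt2_fact // muln_gt0 fact_gt0.
by rewrite muln_gt0 !fact_gt0.
Qed.

(** The hook length formula for (a-1, t), in the form taken by the weights in the limit: a! is
    ((a-1)+1)! and a-t is (a-1)-t+1. *)
Lemma num_syt2_hook (a t : nat) : (t < a)%N ->
  (num_syt [:: (a - 1)%N; t])%:R
  = ((a - 1 + t)`!)%:R / ((a`!)%:R * (t`!)%:R) * (a%:R - t%:R) :> R.
Proof.
move=> ta.
have := congr1 (fun n => n%:R : R) (@num_syt2_fact (a - 1) t ltac:(lia)).
have -> : (a - 1).+1 = a by lia.
have -> : (a - 1 - t).+1 = (a - t)%N by lia.
have fact_neq0 n : (n`!)%:R != 0 :> R by rewrite pnatr_eq0 -lt0n fact_gt0.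
move: (fact_neq0 a) (fact_neq0 t).
rewrite -natrB; last exact: ltnW.
move: (a`!)%N (t`!)%N ((a - 1 + t)`!)%N (a - t)%N (num_syt _) => A T B d f.
move=> A0 T0; rewrite !natrM => e.
rewrite mulrAC -e; field.
by rewrite T0 A0.
Qed.

Lemma prob_before_syt2 (p q a b : nat) :
  (0 < b < a)%N -> (a <= p)%N -> (b <= q <= p)%N ->
  prob_before R (cell_poset [:: p; q]) ((1%N, a) : cell) ((2%N, b) : cell)
  = ((num_skew_syt [:: p; q] [:: a])%:R
      + \sum_(1 <= t < b) (num_syt [:: (a - 1)%N; t])%:R
          * (num_skew_syt [:: (p - t)%N; (q - t)%N] [:: (a - t)%N])%:R)
     / (num_syt [:: p; q])%:R.
Proof.
move=> ba ap bqp.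
rewrite /prob_before before_syt2 // natrD natr_sum.
by congr ((_ + _) / _); apply: eq_bigr => t _; rewrite natrM.
Qed.

End limits.

(** * The exact formula and the limit *)

Theorem theorem4p11 (R : realType) :
  (forall l1 l2 a b : nat, (1 < b)%N -> (b < l2)%N -> (l2 < a)%N -> (a < l1)%N ->
     prob_before R (cell_poset [:: l1; l2]) ((1%N, a) : cell) ((2%N, b) : cell)
     = ((num_skew_syt [:: l1; l2] [:: a])%:R
        + \sum_(1 <= t < b) (num_syt [:: (a - 1)%N; t])%:R
            * (num_skew_syt [:: (l1 - t)%N; (l2 - t)%N] [:: (a - t)%N])%:R)
       / (num_syt [:: l1; l2])%:R
     /\
     ((num_skew_syt [:: l1; l2] [:: a])%:R
        + \sum_(1 <= t < b) (num_syt [:: (a - 1)%N; t])%:R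
            * (num_skew_syt [:: (l1 - t)%N; (l2 - t)%N] [:: (a - t)%N])%:R)
       / (num_syt [:: l1; l2])%:R
     = (num_skew_syt [:: l1; l2] [:: a])%:R / (num_syt [:: l1; l2])%:R
       + \sum_(1 <= t < b) (num_syt [:: (a - 1)%N; t])%:R
           * ((num_skew_syt [:: (l1 - t)%N; (l2 - t)%N] [:: (a - t)%N])%:R
              / (num_syt [:: (l1 - t)%N; (l2 - t)%N])%:R)
           * ((num_syt [:: (l1 - t)%N; (l2 - t)%N])%:R / (num_syt [:: l1; l2])%:R)
           :> R)
  /\
  (forall a b r : nat, (1 < b)%N -> (b < a)%N -> (0 < r)%N ->
     (fun l : nat * nat =>
        prob_before R (cell_poset [:: l.1; l.2]) ((1%N, a) : cell) ((2%N, b) : cell))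
       @ within [set l : nat * nat | (l.2 <= l.1 <= l.2 + r)%N]
           (filter_prod \oo \oo)
     --> (2 ^- a * ((a + 1)%:R
           + \sum_(1 <= t < b) (((a - 1 + t)`!)%:R / ((a`!)%:R * (t`!)%:R)
               * (a%:R - t%:R) * (a%:R - t%:R + 1) * 2 ^- t)) : R)).
Proof.
split=> [l1 l2 a b b1 bl2 l2a al1|a b r b1 ba r0].
  split; first by apply: prob_before_syt2; lia.
  rewrite mulrDl mulr_suml; congr (_ + _); apply: eq_big_nat => t tb.
  by rewrite -!mulrA mulKf // num_syt2_neq0 //; lia.
set F := within _ _.
have FF : Filter F by exact: within_filter.
have lim t : (t < b)%N ->
    (fun l : nat * nat => (num_skew_syt [:: l.1; l.2] [:: a; t])%:R
       / (num_syt [:: l.1; l.2])%:R) @ F --> ((a - t).+1%:R * 2^-1 ^+ (a + t) : R).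
  by move=> tb; apply: cvg_skew2_ratio; lia.
(* The claimed limit is put in the form of a sum of termwise limits, the summand a+1 being the case
   [t = 0]. The guard [t < b] is repeated as a filter so that [lim] applies inside the big sum. *)
have -> : 2 ^- a * ((a + 1)%:R
           + \sum_(1 <= t < b) (((a - 1 + t)`!)%:R / ((a`!)%:R * (t`!)%:R)
               * (a%:R - t%:R) * (a%:R - t%:R + 1) * 2 ^- t))
    = (a - 0).+1%:R * 2^-1 ^+ (a + 0)
      + \sum_(1 <= t < b | (t < b)%N) (num_syt [:: (a - 1)%N; t])%:R
          * ((a - t).+1%:R * 2^-1 ^+ (a + t)) :> R.
  rewrite mulrDr subn0 !addn0 addn1 mulrC exprVn; congr (_ + _).
  rewrite mulr_sumr big_nat_cond [RHS]big_nat_cond; apply: eq_big => [t|t tb]; first lia.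
  rewrite num_syt2_hook; last lia.
  rewrite -[(a - t).+1%:R]natr1 natrB; last lia.
  by rewrite -exprVn exprD -exprVn; ring.
have lims : (fun l : nat * nat => (num_skew_syt [:: l.1; l.2] [:: a; 0%N])%:R
       / (num_syt [:: l.1; l.2])%:R
    + \sum_(1 <= t < b | (t < b)%N) (num_syt [:: (a - 1)%N; t])%:R
          * ((num_skew_syt [:: l.1; l.2] [:: a; t])%:R
       / (num_syt [:: l.1; l.2])%:R)) @ F -->
    ((a - 0).+1%:R * 2^-1 ^+ (a + 0)
      + \sum_(1 <= t < b | (t < b)%N) (num_syt [:: (a - 1)%N; t])%:R
          * ((a - t).+1%:R * 2^-1 ^+ (a + t)) : R).
  apply: cvgD; first by apply: lim; lia.
  apply: cvg_big => [|t tb]; first exact: add_continuous.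
  by apply: cvgM; [exact: cvg_cst|exact: lim].
(* Eventually [a <= l.2], so the exact formula is available; undoing the shift by [t] columns then
   expresses every term through paths from (a, t) to the full shape. *)
apply: cvg_trans lims; apply: near_eq_cvg; near=> l.
have lE : (l.2 <= l.1 <= l.2 + r)%N by near: l; exact: near_diag_le.
have al : (a <= l.2)%N by near: l; exact: near_diag_ge.
rewrite prob_before_syt2; [|lia..].
rewrite mulrDl mulr_suml; congr (_ + _).
rewrite big_nat_cond [RHS]big_nat_cond; apply: eq_big => [t|t tb]; first lia.
rewrite mulrA; congr (_ * _%:R / _).
have := @num_skew2_shift l.1 l.2 a t t; rewrite subnn num_skew2_row => -> //; lia.
Unshelve. all: by end_near. Qed.
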